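(* Let $n,p,q$ be nonnegative integers. Then $$G_{n+2}(p,q)=\sum_{r=p+1}^{p+q+1}\binom{r-1}{p}\sum_{|\alpha|=p+q+1}\zeta(\alpha_1,\ldots,\alpha_{r-1},\alpha_r+n+1)$$ and $$G_{n+2}(p,q)=\frac{1}{p!\,q!\,n!}\int_{E_2}\left(\log\frac{1}{1-t_1}\right)^p\left(\log\frac{1}{1-t_2}\right)^q\left(\log\frac{t_2}{t_1}\right)^n\frac{dt_1\,dt_2}{(1-t_1)t_2}.$$
   Context: For positive integers $\alpha_1,\ldots,\alpha_r$ with $\alpha_r\ge 2$, the multiple zeta value is $\zeta(\alpha_1,\ldots,\alpha_r)=\sum_{1\le k_1<k_2<\cdots<k_r}k_1^{-\alpha_1}\cdots k_r^{-\alpha_r}$. For nonnegative integers $n,p,q$, $$G_{n+2}(p,q)=\sum_{1\le k_1<\cdots<k_{p+1}}\frac{1}{k_1\cdots k_p\,k_{p+1}^{n+2}}\sum_{1\le \ell_1\le \ell_2\le\cdots\le\ell_q\le k_{p+1}}\frac{1}{\ell_1\cdots\ell_q}.$$ For fixed $r$, $\sum_{|\alpha|=m}$ denotes the sum over all $r$-tuples $\alpha=(\alpha_1,\ldots,\alpha_r)$ of positive integers with $\alpha_1+\cdots+\alpha_r=m$. $E_2=\{(t_1,t_2)\in\mathbb{R}^2: 0<t_1<t_2<1\}$. *)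

(* Defs.v *)
From HB Require Import structures.
From mathcomp Require Import all_boot all_order all_algebra.
From mathcomp Require Import all_classical all_reals all_analysis.
Set Implicit Arguments. Unset Strict Implicit. Unset Printing Implicit Defensive.
Import Order.TTheory GRing.Theory Num.Theory.
Import numFieldNormedType.Exports.
Local Open Scope classical_set_scope.
Local Open Scope ring_scope.

Section Defs.
Variable R : realType.

Fixpoint incsum (m : nat) (a : seq nat) (N : nat) : R :=
  match a with
  | [::] => 1
  | a1 :: a' => \sum_(m.+1 <= k < N.+1) (k%:R ^- a1) * incsum k a' N
  end.

Definition mzv_trunc (a : seq nat) (N : nat) : R := incsum 0 a N.

Definition mzv (a : seq nat) : \bar R :=
  limn (fun N => (mzv_trunc a N)%:E).

Fixpoint nondecsum (lo q m : nat) : R :=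
  match q with
  | 0 => 1
  | q'.+1 => \sum_(lo <= l < m.+1) (l%:R)^-1 * nondecsum l q' m
  end.

(* Truncation of G_{n+2}(p,q): k_{p+1} <= N. *)
Definition G_trunc (n p q N : nat) : R :=
  \sum_(1 <= k < N.+1)
     (k%:R ^- (n + 2)) * incsum 0 (nseq p 1%N) k.-1 * nondecsum 1 q k.

Definition G (n p q : nat) : \bar R := limn (fun N => (G_trunc n p q N)%:E).

Definition compositions (r m : nat) : pred {ffun 'I_r -> 'I_m.+1} :=
  fun a => [forall i, 0 < (a i : nat)]%N && (\sum_(i < r) (a i : nat) == m)%N.

Definition shift_last (r m s : nat) (a : {ffun 'I_r -> 'I_m.+1}) : seq nat :=
  [seq (if (nat_of_ord i == r.-1)%N then (a i : nat) + s else (a i : nat))%N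
  | i : 'I_r <- enum 'I_r].

Definition E2 : set (R * R) := [set t | 0 < t.1 /\ t.1 < t.2 /\ t.2 < 1].

Definition integrand (n p q : nat) (t : R * R) : R :=
  (ln (1 / (1 - t.1))) ^+ p * (ln (1 / (1 - t.2))) ^+ q
  * (ln (t.2 / t.1)) ^+ n / ((1 - t.1) * t.2).

End Defs.

(* Main.v *)
Require Import Defs.
From HB Require Import structures.
From mathcomp Require Import all_boot all_order all_algebra.
From mathcomp Require Import all_classical all_reals all_analysis.
From mathcomp Require Import measurable_realfun ring lra zify.
Import Order.TTheory GRing.Theory Num.Theory.
Import numFieldNormedType.Exports.
Local Open Scope classical_set_scope.
Local Open Scope ring_scope.

(** Write [e_p(k)] and [h_q(k)] for the elementary and complete homogeneous
    symmetric functions of [1, 1/2, ..., 1/k].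

    First identity: it holds termwise in the largest index [k + 1]. As
    [(1 + u x)/(1 - v x) = 1 + (u + v) x/(1 - v x)], the coefficient of
    [u^p v^q] in [\prod_(i <= k) (1 + u/i)/(1 - v/i)] is on one hand
    [e_p(k) h_q(k)], and on the other hand the sum over [r] of ['C(r, p)] times
    the sum over compositions of [p + q] into [r] parts of the corresponding
    truncated multiple sums; a last factor [1/(k + 1 - v)] takes care of the
    largest index.

    Second identity: [(log 1/(1 - t))^p / (p! (1 - t))] is the power series
    with coefficients [e_p(k)]. Integrating termwise, first over [t1], where
    [t1^k (log t2/t1)^n] contributes [n! t2^(k+1) / (k+1)^(n+1)], and then over
    [t2], where [t2^k (log 1/(1 - t2))^q] contributes [q! h_q(k+1) / (k+1)],
    gives the series defining [G]. *)

(** * Truncated multiple sums *)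

Lemma exchange_big_nat_lt (R : nmodType) (m N : nat) (F : nat -> nat -> R) :
  \sum_(m <= j < N) \sum_(j.+1 <= k < N) F j k =
  \sum_(m <= k < N) \sum_(m <= j < k) F j k.
Proof.
transitivity (\sum_(m <= j < N) \sum_(m <= k < N | (j < k)%N) F j k).
  apply: eq_big_nat => j /andP[mj jN].
  rewrite (big_nat_widenl _ m) ?(leq_trans mj)//.
rewrite (exchange_big_dep_nat predT)//=; apply: eq_big_nat => k /andP[mk kN].
by rewrite [RHS](big_nat_widen _ _ N) ?(ltnW kN).
Qed.

Lemma exchange_big_nat_le (R : nmodType) (m N : nat) (F : nat -> nat -> R) :
  \sum_(m <= j < N) \sum_(j <= k < N) F j k =
  \sum_(m <= k < N) \sum_(m <= j < k.+1) F j k.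
Proof.
transitivity (\sum_(m <= j < N) \sum_(m <= k < N | (j <= k)%N) F j k).
  apply: eq_big_nat => j /andP[mj jN].
  by rewrite (big_nat_widenl _ m).
rewrite (exchange_big_dep_nat predT)//=; apply: eq_big_nat => k /andP[mk kN].
by rewrite [RHS](big_nat_widen _ _ N).
Qed.

Section multiple_harmonic_sums.
Variable R : realType.

Lemma incsum_ge0 m a N : 0 <= incsum R m a N.
Proof.
elim: a m => [|a1 a IH] m //=.
by apply: sumr_ge0 => k _; rewrite mulr_ge0 ?IH// invr_ge0 exprn_ge0.
Qed.

(** [incsum] recurses on the smallest index, while [G] and the shifted exponent single out the
    largest one. Exchanging the order of summation moves the recursion to that end; [k >= m.+1]
    makes [k.-1] a true predecessor. *)
Lemma incsum_rcons m a b N :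
  incsum R m (rcons a b) N =
  \sum_(m.+1 <= k < N.+1) k%:R ^- b * incsum R m a k.-1.
Proof.
elim: a m => [|a1 a IH] m //=.
under eq_bigr => k _ do rewrite IH mulr_sumr.
rewrite exchange_big_nat_lt; apply: eq_big_nat => k /andP[mk _].
rewrite mulr_sumr prednK ?(leq_trans _ mk)//.
by apply: eq_bigr => j _; rewrite mulrCA.
Qed.

Lemma nondecsum_ge0 m q N : 0 <= nondecsum R m q N.
Proof.
elim: q m => [|q IH] m //=.
by apply: sumr_ge0 => k _; rewrite mulr_ge0 ?IH// invr_ge0.
Qed.

(** The definition fixes the upper bound and raises the lower one. With the largest index outermost,
    the passage from [k] to [k.+1] adds a single term, as [hom_sumS] requires. *)
Lemma nondecsum_last m q N :
  nondecsum R m q.+1 N =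
  \sum_(m <= l < N.+1) l%:R^-1 * nondecsum R m q l.
Proof.
elim: q m => [|q IH] m //.
have -> : nondecsum R m q.+2 N =
  \sum_(m <= l < N.+1) l%:R^-1 * nondecsum R l q.+1 N by [].
under eq_bigr => k _ do rewrite IH mulr_sumr.
rewrite exchange_big_nat_le; apply: eq_big_nat => k _.
by rewrite /= mulr_sumr; apply: eq_bigr => j _; rewrite mulrCA.
Qed.

Let E p k : R := incsum R 0 (nseq p 1%N) k.
Let H q k : R := nondecsum R 1 q k.

Lemma elem_sum_rec p k :
  incsum R 0 (nseq p.+1 1%N) k =
  \sum_(1 <= j < k.+1) j%:R^-1 * incsum R 0 (nseq p 1%N) j.-1.
Proof.
have -> : nseq p.+1 1%N = rcons (nseq p 1%N) 1%N.
  by rewrite -cats1 cat_nseq -[[:: 1%N]]/(nseq 1 1%N) /ncons -iterD addn1.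
by rewrite incsum_rcons; apply: eq_bigr => j _; rewrite expr1.
Qed.

Lemma elem_sumS p k : E p.+1 k.+1 = E p.+1 k + k.+1%:R^-1 * E p k.
Proof. by rewrite /E !elem_sum_rec (big_nat_recr k.+1). Qed.

Lemma elem_sum0 p : E p 0 = (p == 0%N)%:R.
Proof. by case: p => //= p; rewrite /E elem_sum_rec big_geq. Qed.

Lemma hom_sumS q k : H q.+1 k.+1 = H q.+1 k + k.+1%:R^-1 * H q k.+1.
Proof. by rewrite /H !nondecsum_last (big_nat_recr k.+1). Qed.

Lemma hom_sum0 q : H q 0 = (q == 0%N)%:R.
Proof. by case: q => //= q; rewrite /H nondecsum_last big_geq. Qed.

(** The coefficient of [w^r x^m] in [\prod_(j <= k) (1 + w (x/j)/(1 - x/j))], unfolded along the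
    largest index [j] and its exponent [i]. *)
Fixpoint comp_sum (r m k : nat) : R :=
  if r is r'.+1 then
    \sum_(1 <= j < k.+1) \sum_(1 <= i < m.+1)
       j%:R ^- i * comp_sum r' (m - i) j.-1
  else (m == 0%N)%:R.

(** The part of [comp_sum r.+1 m] carried by tuples whose largest index is exactly [k.+1]; [r]
    counts the remaining indices. *)
Definition comp_sum_at (r m k : nat) : R :=
  \sum_(1 <= i < m.+1) k.+1%:R ^- i * comp_sum r (m - i) k.

Lemma comp_sumS r m k :
  comp_sum r.+1 m k.+1 = comp_sum r.+1 m k + comp_sum_at r m k.
Proof. by rewrite /= (big_nat_recr k.+1). Qed.

Lemma comp_sum_at0 r k : comp_sum_at r 0 k = 0.
Proof. by rewrite /comp_sum_at big_geq. Qed.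

(** Geometric series in the last exponent: it is either 1, or one factor [1/(k+1)] comes out and
    lowers it by 1. *)
Lemma comp_sum_atS r m k :
  comp_sum_at r m.+1 k = k.+1%:R^-1 * (comp_sum r m k + comp_sum_at r m k).
Proof.
rewrite /comp_sum_at big_nat_recl// expr1 subn1 mulrDr; congr (_ + _).
rewrite mulr_sumr; apply: eq_big_nat => i /andP[i0 im].
by rewrite exprS invfM mulrA subSS.
Qed.

Lemma comp_sum_gt r m k : (m < r)%N -> comp_sum r m k = 0.
Proof.
elim: r m k => // r IH m k mr /=; rewrite big1// => j _.
rewrite big_nat big1// => i /andP[i0 im]; rewrite IH ?mulr0//; lia.
Qed.

Lemma comp_sum0 r m : comp_sum r m 0 = ((r == 0%N) && (m == 0%N))%:R.
Proof. by case: r => //= r; rewrite big_geq. Qed.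

Arguments comp_sum : simpl never.

(** With [y = 1/(k+1)], the new factor [1 + w x y/(1 - x y)] becomes [1 - x y + w x y] after
    multiplication by [1 - x y]; this is the coefficient of [w^(r+1) x^(m+1)]. *)
Lemma comp_sum_rec r m k :
  comp_sum r.+1 m.+1 k.+1 - k.+1%:R^-1 * comp_sum r.+1 m k.+1 =
  comp_sum r.+1 m.+1 k - k.+1%:R^-1 * comp_sum r.+1 m k
  + k.+1%:R^-1 * comp_sum r m k.
Proof. rewrite !comp_sumS comp_sum_atS; ring. Qed.

(* Coefficientwise form of
   [\prod_(i <= k) (1 + u/i)/(1 - v/i) = \prod_(i <= k) (1 + (u + v)/i/(1 - v/i))]:
   both sides are determined by the recurrence obtained from multiplying
   by [1 - v/(k+1)]. *)
Lemma binomial_comp_sum B p m k : (m < B)%N ->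
  \sum_(r < B) 'C(r, p)%:R * comp_sum r m k =
  if (p <= m)%N then E p k * H (m - p) k else 0.
Proof.
elim: k p m => [|k IHk] p m mB.
  case: B mB => // B mB; rewrite big_ord_recl big1 ?addr0; last first.
    by move=> i _; rewrite comp_sum0 mulr0.
  rewrite elem_sum0 hom_sum0 bin0n comp_sum0 /=.
  case: p => [|p]; first by rewrite subn0.
  by rewrite !mul0r if_same.
elim: m mB => [|m IHm] mB.
  case: B mB {IHk} => // B mB; rewrite big_ord_recl big1 ?addr0; last first.
    by move=> i _; rewrite comp_sum_gt ?mulr0.
  by rewrite /= bin0n; case: p => [|p]; rewrite ?mulr1 // mul0r.
set x : R := k.+1%:R^-1.
have rec : \sum_(r < B) 'C(r, p)%:R * comp_sum r m.+1 k.+1 =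
    x * (\sum_(r < B) 'C(r, p)%:R * comp_sum r m k.+1) +
    \sum_(r < B) 'C(r, p)%:R * comp_sum r m.+1 k +
    x * (if p is p'.+1 then \sum_(r < B) 'C(r, p')%:R * comp_sum r m k else 0).
  case: B {IHk IHm} mB => // B mB.
  (* The added top term has more parts than its total [m], hence is zero. *)
  have shift p' : \sum_(i < B) 'C(i, p')%:R * comp_sum i m k =
      \sum_(r < B.+1) 'C(r, p')%:R * comp_sum r m k.
    by rewrite big_ord_recr /= comp_sum_gt// mulr0 addr0.
  (* Pascal's rule: the shift of [r] in [comp_sum_rec] becomes the shift from [p] to [p']. *)
  have -> : (if p is p'.+1 then \sum_(r < B.+1) 'C(r, p')%:R * comp_sum r m k
      else 0) = \sum_(r < B.+1) ('C(r.+1, p)%:R - 'C(r, p)%:R) * comp_sum r m k.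
    case: p => [|p].
      by rewrite big1// => i _; rewrite !bin0 subrr mul0r.
    by apply: eq_bigr => i _; rewrite binS natrD addrAC subrr add0r.
  under [X in _ + x * X]eq_bigr => i _ do rewrite mulrBl.
  rewrite sumrB.
  have -> : \sum_(i < B.+1) 'C(i.+1, p)%:R * comp_sum i m k =
    \sum_(i < B) 'C(i.+1, p)%:R * comp_sum i m k.
    by rewrite big_ord_recr /= [comp_sum B m k]comp_sum_gt// mulr0 addr0.
  rewrite 4!big_ord_recl.
  under eq_bigr => i _ do rewrite lift0.
  under [X in x * (_ + X) + _ + _]eq_bigr => i _ do rewrite lift0.
  under [X in _ + (_ + X) + _]eq_bigr => i _ do rewrite lift0.
  under [X in _ + _ + x * (_ - (_ + X))]eq_bigr => i _ do rewrite lift0.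
  have -> : \sum_(i < B) 'C(i.+1, p)%:R * comp_sum i.+1 m.+1 k.+1 =
    x * (\sum_(i < B) 'C(i.+1, p)%:R * comp_sum i.+1 m k.+1) +
    \sum_(i < B) 'C(i.+1, p)%:R * comp_sum i.+1 m.+1 k +
    x * (\sum_(i < B) 'C(i.+1, p)%:R * comp_sum i m k) -
    x * (\sum_(i < B) 'C(i.+1, p)%:R * comp_sum i.+1 m k).
    rewrite !mulr_sumr -!big_split -sumrB; apply: eq_bigr => i _.
    have := comp_sum_rec i m k; rewrite -/x => /eqP; rewrite subr_eq => /eqP ->.
    by rewrite /=; ring.
  have -> j n : comp_sum ord0 n j = (n == 0%N)%:R by [].
  have -> j n : comp_sum ord0 n j = (n == 0%N)%:R by [].
  have -> j n : comp_sum ord0 n j = (n == 0%N)%:R by [].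
  by rewrite /=; ring.
have mB' := ltn_trans (ltnSn m) mB.
rewrite rec IHk// IHm// {IHm rec}; case: p => [|p].
  by rewrite !leq0n mulr0 addr0 !subn0 hom_sumS /E /= -/x; ring.
rewrite IHk// ltnS subSS; case: (ltngtP p m) => pm.
- rewrite elem_sumS -/x (_ : (m - p)%N = (m - p.+1).+1); last by lia.
  by rewrite hom_sumS -/x; ring.
- by rewrite !mulr0 !addr0.
- by rewrite pm subnn elem_sumS /H /= -/x; ring.
Qed.

(** By induction on [m], [comp_sum_atS] adds the value of [binomial_comp_sum] to the previous case,
    and [hom_sumS] merges the two into [h(k+1)]. As [r] omits the largest index, ['C(r, p)] is the
    binomial ['C(r.-1, p)] of the theorem. *)
Lemma binomial_comp_sum_at B p m k : (m <= B)%N ->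
  \sum_(r < B) 'C(r, p)%:R * comp_sum_at r m k =
  if (p < m)%N then k.+1%:R^-1 * (E p k * H (m - p.+1) k.+1) else 0.
Proof.
elim: m => [|m IH] mB.
  by rewrite big1// => i _; rewrite comp_sum_at0 mulr0.
under eq_bigr => i _ do rewrite comp_sum_atS mulrCA mulrDr.
rewrite -mulr_sumr big_split binomial_comp_sum// IH; last exact: ltnW.
rewrite ltnS subSS; case: (ltngtP p m) => pm.
- by rewrite /= (_ : (m - p)%N = (m - p.+1).+1) ?hom_sumS; [ring|lia].
- by rewrite /= addr0 mulr0.
- by rewrite /= addr0 pm subnn.
Qed.

(** * Compositions as finite functions *)

Lemma widen_lift_max r (i : 'I_r) :
  widen_ord (leqnSn r) i = lift ord_max i.
Proof. by apply/val_inj; rewrite /= /bump leqNgt ltn_ord. Qed.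

(** The codomain bound [M] is kept apart from the total: removing the last part lowers the total to
    [m - i], whereas the type of functions must stay the same for an induction on [r]. *)
Lemma big_compositions_rcons M r m (F : seq nat -> nat -> R) : (m < M)%N ->
  \sum_(a : {ffun 'I_r.+1 -> 'I_M} |
        [forall i, 0 < (a i : nat)]%N && (\sum_i (a i : nat) == m)%N)
     F [seq (a (lift ord_max i) : nat) | i <- enum 'I_r] (a ord_max) =
  \sum_(1 <= i < m.+1)
    \sum_(b : {ffun 'I_r -> 'I_M} |
          [forall j, 0 < (b j : nat)]%N && (\sum_j (b j : nat) == m - i)%N)
       F [seq (b j : nat) | j <- enum 'I_r] i.
Proof.
move=> mM; rewrite (big_nat_widenl _ 0)// (big_nat_widen _ _ M)// big_mkord.
rewrite pair_big_dep/=.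
(* [g] appends a last part to a tuple; it is the bijection used for reindexing. *)
pose g (x : 'I_M * {ffun 'I_r -> 'I_M}) : {ffun 'I_r.+1 -> 'I_M} :=
  [ffun i => oapp x.2 x.1 (unlift ord_max i)].
have gm x : g x ord_max = x.1 by rewrite ffunE unlift_none.
have gl x i : g x (lift ord_max i) = x.2 i by rewrite ffunE liftK.
rewrite (reindex g); last first.
  exists (fun a : {ffun 'I_r.+1 -> 'I_M} =>
      (a ord_max, [ffun i : 'I_r => a (lift ord_max i)])).
    move=> [i b] _; congr pair; first exact: gm.
    by apply/ffunP => j; rewrite ffunE gl.
  move=> a _; apply/ffunP => i; case: (unliftP ord_max i) => [j ->|->].
    by rewrite gl ffunE.
  by rewrite gm.
apply: eq_big => [[i b]|[i b] _]; last first.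
  by rewrite gm; congr (F _ _); apply: eq_map => j; rewrite gl.
rewrite big_ord_recr gm /=.
have -> : (\sum_(j < r) g (i, b) (widen_ord (leqnSn r) j) =
    \sum_(j < r) (b j : nat))%N.
  by apply: eq_bigr => j _; rewrite widen_lift_max gl.
have -> : [forall j, 0 < g (i, b) j]%N = (0 < i)%N && [forall j, 0 < b j]%N.
  apply/forallP/andP => [g0|[i0 /forallP b0] j].
    split; first by have := g0 ord_max; rewrite gm.
    by apply/forallP => j; have := g0 (lift ord_max j); rewrite gl.
  by case: (unliftP ord_max j) => [k ->|->]; rewrite ?gl// gm.
rewrite andbC; case: [forall j, _] => /=; last by rewrite !andbF.
rewrite andbT; lia.
Qed.

Lemma big_compositions_incsum M r m k : (m < M)%N ->
  \sum_(a : {ffun 'I_r -> 'I_M} |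
        [forall i, 0 < (a i : nat)]%N && (\sum_i (a i : nat) == m)%N)
     incsum R 0 [seq (a i : nat) | i <- enum 'I_r] k = comp_sum r m k.
Proof.
elim: r m k => [|r IH] m k mM.
  rewrite [RHS]/comp_sum; have [->|m0] := eqVneq m 0%N; last first.
    by rewrite big_pred0// => a; rewrite big_ord0 eq_sym (negbTE m0) andbF.
  rewrite (big_pred1 [ffun=> Ordinal mM]); first by rewrite enum_ord0.
  move=> a; rewrite big_ord0 eqxx andbT /=.
  rewrite (_ : a = [ffun=> Ordinal mM]) ?eqxx; first by apply/forallP; case.
  by apply/ffunP; case.
rewrite /comp_sum -/comp_sum.
pose F s i := \sum_(1 <= j < k.+1) j%:R ^- i * incsum R 0 s j.-1 : R.
rewrite (eq_bigr (fun a : {ffun 'I_r.+1 -> 'I_M} =>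
  F [seq (a (lift ord_max i) : nat) | i <- enum 'I_r] (a ord_max))); last first.
  move=> a _; rewrite enum_ordSr map_rcons incsum_rcons -map_comp.
  by congr F; apply: eq_map => i /=; rewrite widen_lift_max.
rewrite big_compositions_rcons// /F.
under eq_bigr do rewrite exchange_big.
rewrite exchange_big; apply: eq_bigr => j _; apply: eq_big_nat => i /andP[i0 im].
rewrite -mulr_sumr IH//; lia.
Qed.

Lemma shift_lastE r m s (a : {ffun 'I_r.+1 -> 'I_m.+1}) :
  shift_last s a =
  rcons [seq (a (lift ord_max i) : nat) | i <- enum 'I_r] (a ord_max + s)%N.
Proof.
rewrite /shift_last enum_ordSr map_rcons /= eqxx -map_comp; congr rcons.
by apply: eq_map => i /=; rewrite ltn_eqF// widen_lift_max.
Qed.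

Lemma G_term_comp_sum n p q k :
  k.+1%:R ^- (n + 2) * incsum R 0 (nseq p 1%N) k * nondecsum R 1 q k.+1 =
  \sum_(p <= r < (p + q).+1) 'C(r, p)%:R *
     \sum_(1 <= i < (p + q).+2)
        k.+1%:R ^- (i + n.+1) * comp_sum r ((p + q).+1 - i) k.
Proof.
have := @binomial_comp_sum_at (p + q).+1 p (p + q).+1 k (leqnn _).
rewrite ltnS leq_addr subSS addKn => Heq.
have -> : k.+1%:R ^- (n + 2) * incsum R 0 (nseq p 1%N) k * nondecsum R 1 q k.+1
   = k.+1%:R ^- n.+1 * (k.+1%:R^-1 * (E p k * H q k.+1)).
  by rewrite addn2 exprSr invfM /E /H; ring.
rewrite -{}Heq mulr_sumr -[in LHS](big_mkord xpredT (fun r => k.+1%:R ^- n.+1 *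
  ('C(r, p)%:R * comp_sum_at r (p + q).+1 k))).
(* The terms with [r < p] drop out because ['C(r, p) = 0]. *)
rewrite (big_cat_nat (leq0n p) (leq_trans (leq_addr q p) (leqnSn _)))/=.
rewrite big_nat big1 ?add0r; last first.
  by move=> r /andP[_ rp]; rewrite bin_small// mul0r mulr0.
apply: eq_bigr => r _; rewrite mulrCA; congr (_ * _); rewrite mulr_sumr.
by apply: eq_bigr => i _; rewrite exprD invfM; ring.
Qed.


(** The first identity already holds for each truncation, by summing [G_term_comp_sum] over the
    largest index; only a limit in [N] then remains. *)
Lemma G_trunc_sum n p q N :
  G_trunc R n p q N =
  \sum_(p.+1 <= r < (p + q).+2) 'C(r.-1, p)%:R *
     \sum_(a : {ffun 'I_r -> 'I_(p + q).+2} | compositions a)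
        mzv_trunc R (shift_last n.+1 a) N.
Proof.
rewrite big_add1 /G_trunc big_add1.
under eq_bigr => k _ do rewrite G_term_comp_sum.
rewrite exchange_big; apply: eq_bigr => r _; rewrite -mulr_sumr; congr (_ * _).
pose F s i := \sum_(0 <= k < N) k.+1%:R ^- (i + n.+1) * incsum R 0 s k : R.
rewrite [RHS](eq_bigr (fun a : {ffun 'I_r.+1 -> 'I_(p + q).+2} =>
  F [seq (a (lift ord_max i) : nat) | i <- enum 'I_r] (a ord_max))); last first.
  by move=> a _; rewrite shift_lastE /mzv_trunc incsum_rcons big_add1.
rewrite big_compositions_rcons// /F exchange_big.
apply: eq_big_nat => i /andP[i0 im]; rewrite exchange_big.
by apply: eq_bigr => k _; rewrite -mulr_sumr big_compositions_incsum//; lia.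
Qed.

(** * Passage to the limit in the first identity *)

Lemma incsum_le m a M N : (M <= N)%N -> incsum R m a M <= incsum R m a N.
Proof.
move=> MN; case/lastP: a => [//|a b]; rewrite !incsum_rcons.
have [mM|Mm] := leqP m M; last first.
  rewrite [leLHS]big_geq; last by rewrite ltnW.
  by apply: sumr_ge0 => k _; rewrite mulr_ge0 ?incsum_ge0// invr_ge0 exprn_ge0.
rewrite [leRHS](@big_cat_nat _ _ _ M.+1)//= lerDl.
by apply: sumr_ge0 => k _; rewrite mulr_ge0 ?incsum_ge0// invr_ge0 exprn_ge0.
Qed.

Lemma cvg_mzv a : (mzv_trunc R a N)%:E @[N --> \oo] --> mzv R a.
Proof.
apply: ereal_nondecreasing_is_cvgn => M N MN.
by rewrite lee_fin; exact: incsum_le.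
Qed.

(** The truncated sums are nonnegative, so limits in the extended reals pass through the finite sums
    with no indeterminate form. *)
Lemma G_mzv n p q :
  @G R n p q =
    (\sum_(p.+1 <= r < (p + q).+2)
       ('C(r.-1, p)%:R)%:E *
       \sum_(a : {ffun 'I_r -> 'I_(p + q).+2} | compositions a)
          @mzv R (shift_last n.+1 a))%E.
Proof.
rewrite /G; apply/cvg_lim => //.
have S0 r N : (0 <= \sum_(a : {ffun 'I_r -> 'I_(p + q).+2} | compositions a)
    (mzv_trunc R (shift_last n.+1 a) N)%:E)%E.
  by apply: sume_ge0 => a _; rewrite lee_fin; exact: incsum_ge0.
rewrite [X in X @ _ --> _](_ : _ = fun N => (\sum_(p.+1 <= r < (p + q).+2)
    ('C(r.-1, p)%:R)%:E *
     \sum_(a : {ffun 'I_r -> 'I_(p + q).+2} | compositions a)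
       (mzv_trunc R (shift_last n.+1 a) N)%:E)%E); last first.
  apply/funext => N; rewrite G_trunc_sum -sumEFin; apply: eq_bigr => r _.
  by rewrite EFinM -sumEFin.
apply: cvg_nnesum => [r _|r _]; first by apply: nearW => N; rewrite mule_ge0.
apply: cvgeZl => //; apply: cvg_nnesum => [a _|a _]; last exact: cvg_mzv.
by apply: nearW => N; rewrite lee_fin incsum_ge0.
Qed.

End multiple_harmonic_sums.

(** * One-variable integrals *)

Section power_log_integral.
Variable R : realType.
Notation mu := (@lebesgue_measure R).

(** The integrand may be unbounded at the endpoints, so the fundamental theorem is applied on
    compact subintervals [D n], which exhaust the open interval; monotone convergence concludes. *)
Lemma ge0_FTC2oo (f F : R -> R) (a b A B : R) : a < b ->
  (forall x, a < x < b -> 0 <= f x) ->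
  (forall x, a < x < b -> {for x, continuous f}) ->
  (forall x, a < x < b -> is_derive x 1 F (f x)) ->
  F x @[x --> a^'+] --> A -> F x @[x --> b^'-] --> B ->
  (\int[mu]_(x in `]a, b[) (f x)%:E = (B - A)%:E)%E.
Proof.
move=> ab f0 cf dF FA FB.
(* The denominator starts at 3 so that [2 d n < b - a] and [D n] is never degenerate. *)
pose d n : R := (b - a) / n.+3%:R.
have ba0 : 0 < b - a by rewrite subr_gt0.
have d0 n : 0 < d n by rewrite divr_gt0.
have dlt n : d n + d n < b - a.
  rewrite /d -mulrDl ltr_pdivrMr//.
  have : (3:R) <= n.+3%:R by rewrite ler_nat.
  nra.
have dle m n : (m <= n)%N -> d n <= d m.
  by move=> mn; rewrite ler_pM2l// lef_pV2 ?posrE// ler_nat !ltnS.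
have dcvg : d n @[n --> \oo] --> 0.
  rewrite -[X in _ --> X](mulr0 (b - a)); apply: cvgMl_tmp.
  have := @cvg_harmonic R; rewrite -cvg_shiftS -cvg_shiftS; exact.
pose D n : set R := `[a + d n, b - d n]%classic.
have DE : `]a, b[%classic = \bigcup_n D n.
  apply/seteqP; split => [x|x [n _]]; rewrite /D/= !in_itv/=; last first.
    move=> /andP[h1 h2]; have dn := d0 n; by apply/andP; split; lra.
  move=> /andP[ax xb].
  have e0 : 0 < Num.min (x - a) (b - x) by rewrite lt_min !subr_gt0 ax.
  have /cvgrPdist_lt/(_ _ e0)[n _ /(_ n (leqnn n))] := dcvg.
  rewrite sub0r normrN gtr0_norm// lt_min => /andP[h1 h2].
  by exists n => //=; rewrite in_itv/=; apply/andP; split; lra.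
have cD n x : D n x -> a < x < b.
  by rewrite /D/= in_itv/= => /andP[h1 h2]; have dn := d0 n; by apply/andP; split; lra.
have intD n : (\int[mu]_(x in D n) (f x)%:E =
    (F (b - d n) - F (a + d n))%:E)%E.
  rewrite EFinB; apply: continuous_FTC2.
  - by have := dlt n; lra.
  - apply: continuous_in_subspaceT => x /set_mem /cD; exact: cf.
  - have dc x : D n x -> {for x, continuous F}.
      move=> /cD /dF [+ _] => /derivable1_diffP; exact: differentiable_continuous.
    split.
    + by move=> x xab; have [] := dF x (cD n x (subset_itv_oo_cc xab)).
    + apply: cvg_at_right_filter; apply: dc.
      by rewrite /D/= in_itv/= lexx/=; have := dlt n; lra.
    + apply: cvg_at_left_filter; apply: dc.
      by rewrite /D/= in_itv/= lexx andbT; have := dlt n; lra.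
  - move=> x xab; rewrite derive1E.
    by have [] := dF x (cD n x (subset_itv_oo_cc xab)).
have mD n : measurable (D n) by exact: measurable_itv.
have mf n : measurable_fun (D n) f.
  apply: subspace_continuous_measurable_fun => //.
  by apply: continuous_in_subspaceT => x /set_mem /cD; exact: cf.
have ndD : nondecreasing_seq D.
  move=> m n mn; apply/subsetPset => x; rewrite /D/= !in_itv/=.
  by move=> /andP[h1 h2]; have dmn := dle _ _ mn; by apply/andP; split; lra.
have cvg_intD : (\int[mu]_(x in D n) (f x)%:E @[n --> \oo] -->
    \int[mu]_(x in `]a, b[) (f x)%:E)%E.
  rewrite DE; apply: ge0_nondecreasing_set_cvg_integral => //.
  - by move=> n; apply/measurable_EFinP; exact: mf.
  - by move=> n x /cD; rewrite lee_fin; exact: f0.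
rewrite -(cvg_lim _ cvg_intD)//; apply/cvg_lim => //.
under eq_fun do rewrite intD.
apply: cvg_EFin; first exact: nearW.
rewrite /comp/=; apply: cvgB.
- move/cvg_at_leftP : FB; apply; split.
    by move=> n; rewrite ltrBlDr ltrDl.
  by rewrite -[X in _ --> X](subr0 b); apply: cvgB => //; exact: cvg_cst.
- move/cvg_at_rightP : FA; apply; split.
    by move=> n; rewrite ltrDl.
  by rewrite -[X in _ --> X](addr0 a); apply: cvgD => //; exact: cvg_cst.
Qed.

(* From [exp y >= y^(n+1)/(n+1)!] with [y = - ln x]. *)
Lemma cvg_xlnXn n : x * (- ln x) ^+ n @[x --> (0:R)^'+] --> (0:R).
Proof.
apply/cvgr0Pnorm_lt => e e0; near=> x.
have x0 : 0 < x by [].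
pose c : R := n.+1`!%:R.
have c0 : 0 < c by rewrite ltr0n fact_gt0.
(* Threshold chosen so that [x y^(n+1) < c] yields [x y^n < c / y < e]. *)
have yc : c / e < - ln x.
  rewrite ltrNr; near: x.
  by apply: cvgrNy_lt; exact: lnNy.
set y := - ln x in yc *.
have y0 : 0 < y by rewrite (lt_trans _ yc)// divr_gt0.
have ey : expR y = x^-1 by rewrite expRN lnK.
have := expR_ge1Dxn n (ltW y0); rewrite ey -/c => h.
have xc : x * y ^+ n.+1 < c.
  by rewrite -ltr_pdivlMl// -ltr_pdivrMr//; lra.
rewrite ger0_norm; last by rewrite mulr_ge0 ?exprn_ge0// ltW.
rewrite -(ltr_pM2r y0); rewrite ltr_pdivrMr// in yc.
by move: xc; rewrite exprSr mulrA => /lt_trans; apply; rewrite mulrC.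
Unshelve. all: by end_near. Qed.

(** Substituting [t / s] in [cvg_xlnXn] leaves the factor [s t^k], which has a finite limit. *)
Lemma cvg_power_lnXn k n (s : R) : 0 < s ->
  t ^+ k.+1 * (ln s - ln t) ^+ n @[t --> (0:R)^'+] --> (0:R).
Proof.
move=> s0; apply/cvg_at_rightP => u [u0 uc].
have /cvg_at_rightP/(_ (fun m => u m / s)) H := @cvg_xlnXn n.
have {}H : (u m / s) * (- ln (u m / s)) ^+ n @[m --> \oo] --> (0:R).
  apply: H; split; first by move=> m; rewrite divr_gt0// u0.
  by rewrite -[X in _ --> X](mul0r s^-1); exact: cvgMr_tmp.
have -> : (fun m => u m ^+ k.+1 * (ln s - ln (u m)) ^+ n) =
   (fun m => (s * u m ^+ k) * (u m / s * (- ln (u m / s)) ^+ n)).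
  apply/funext => m; rewrite ln_div ?posrE ?u0// opprB exprS.
  have sn0 : s != 0 by rewrite gt_eqF.
  by field.
have uk : s * u m ^+ k @[m --> \oo] --> s * 0 ^+ k.
  apply: cvgMl_tmp; apply: (cvg_comp u (fun x => x ^+ k) uc).
  exact: exprn_continuous.
have := cvgM uk H; rewrite mulr0; exact.
Qed.

Lemma is_derive_subl (f : R -> R) (c x a : R) :
  is_derive x 1 f a -> is_derive x 1 (fun y => c - f y) (- a).
Proof.
by move=> fa; rewrite -sub0r; apply: (is_deriveB (f := cst c)).
Qed.

Lemma is_derive_add (f g : R -> R) (x a b : R) :
  is_derive x 1 f a -> is_derive x 1 g b ->
  is_derive x 1 (fun y => f y + g y) (a + b).
Proof. exact: is_deriveD. Qed.

Lemma is_derive_mul (f g : R -> R) (x a b : R) :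
  is_derive x 1 f a -> is_derive x 1 g b ->
  is_derive x 1 (fun y => f y * g y) (f x * b + g x * a).
Proof. exact: is_deriveM. Qed.

Lemma is_derive_mull (f : R -> R) (c x a : R) :
  is_derive x 1 f a -> is_derive x 1 (fun y => c * f y) (c * a).
Proof. exact: is_deriveZ. Qed.

Lemma is_derive_exp (f : R -> R) n (x a : R) :
  is_derive x 1 f a ->
  is_derive x 1 (fun y => f y ^+ n.+1) (n.+1%:R * f x ^+ n * a).
Proof.
move=> fa; apply: (is_derive1_comp (f := fun y => y ^+ n.+1)).
apply: DeriveDef; first exact: exprn_derivable.
by rewrite exp_derive /GRing.scale /= mulr1.
Qed.

Lemma is_derive_continuous (f : R -> R) (x a : R) :
  is_derive x 1 f a -> {for x, continuous f}.
Proof. by case=> /derivable1_diffP /differentiable_continuous. Qed.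

Lemma power_ln_primitive k n (s : R) : 0 < s -> exists F : R -> R,
  [/\ forall t : R, 0 < t -> is_derive t 1 F (t ^+ k * (ln s - ln t) ^+ n),
      F t @[t --> 0^'+] --> (0:R) &
      F s = n`!%:R * s ^+ k.+1 / k.+1%:R ^+ n.+1].
Proof.
move=> s0; have k0 : (k.+1%:R : R) != 0 by [].
elim: n => [|n [F [dF F0 Fs]]].
  exists (fun t => k.+1%:R^-1 * t ^+ k.+1); split.
  - move=> t t0; apply: is_derive_eq.
      by apply: is_derive_mull; apply: is_derive_exp; exact: is_derive_id.
    by field.
  - rewrite -[X in _ --> X](mulr0 k.+1%:R^-1); apply: cvgMl_tmp.
    apply: cvg_at_right_filter; rewrite -[X in _ --> X](expr0n R k.+1).
    exact: exprn_continuous.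
  - by rewrite fact0 expr1; field.
(* Integration by parts: differentiating the logarithm gives [-1/t], which lowers [t^(k+1)] to [t^k]
   and leaves the integrand of the previous [n]. *)
exists (fun t => k.+1%:R^-1 *
  (t ^+ k.+1 * (ln s - ln t) ^+ n.+1 + n.+1%:R * F t)); split.
- move=> t t0; apply: is_derive_eq.
    apply: is_derive_mull; apply: is_derive_add; last first.
      by apply: is_derive_mull; exact: dF.
    apply: is_derive_mul.
      by apply: is_derive_exp; exact: is_derive_id.
    apply: is_derive_exp; apply: is_derive_subl.
    exact: is_derive1_ln.
  have t0' : t != 0 by rewrite gt_eqF.
  by rewrite [t ^+ k.+1]exprS [_ ^+ n.+1]exprS; field; rewrite ?k0 ?t0' ?nat1r.
- rewrite -[X in _ --> X](mulr0 k.+1%:R^-1); apply: cvgMl_tmp.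
  rewrite -[X in _ --> X](addr0 0); apply: cvgD; first exact: cvg_power_lnXn.
  by rewrite -[X in _ --> X](mulr0 n.+1%:R); exact: cvgMl_tmp.
- rewrite Fs subrr expr0n mulr0 add0r factS natrM [_ ^+ n.+2]exprS.
  by rewrite invfM; ring.
Qed.

Lemma integral_power_ln k n (s : R) : 0 < s ->
  (\int[mu]_(t in `]0%R, s[) (t ^+ k * (ln s - ln t) ^+ n)%:E =
   (n`!%:R * s ^+ k.+1 / k.+1%:R ^+ n.+1)%:E)%E.
Proof.
move=> s0; have [F [dF F0 Fs]] := @power_ln_primitive k n s s0.
rewrite -Fs -[F s]subr0; apply: ge0_FTC2oo F0 _ => //.
- move=> t /andP[t0 ts].
  by rewrite mulr_ge0 ?exprn_ge0 ?subr_ge0 ?ler_ln ?posrE ?(ltW t0) ?(ltW ts).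
- move=> t /andP[t0 ts]; apply: cvgM; first exact: exprn_continuous.
  case: n {dF Fs} => [|n]; first exact: cvg_cst.
  apply: (@is_derive_continuous (fun t => (ln s - ln t) ^+ n.+1)).
  apply: is_derive_exp; apply: is_derive_subl.
  exact: is_derive1_ln.
- by move=> t /andP[t0 _]; exact: dF.
- by apply: cvg_at_left_filter; apply: is_derive_continuous; exact: dF.
Qed.

End power_log_integral.

(** * Integrals of powers times powers of [log 1/(1 - s)] *)

Section power_log_onem_integral.
Variable R : realType.
Notation mu := (@lebesgue_measure R).

Lemma is_derive_bigsum N (f : nat -> R -> R) (x : R) (a : nat -> R) :
  (forall i, is_derive x 1 (f i) (a i)) ->
  is_derive x 1 (fun y => \sum_(i < N) f i y) (\sum_(i < N) a i).
Proof.
move=> fa; rewrite [X in is_derive _ _ X](_ : _ = \sum_(i < N) f i).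
  exact: is_derive_sum.
by apply/funext => y; rewrite fct_sumE.
Qed.

Lemma is_derive_onem_lnX n (s : R) : s < 1 ->
  is_derive s 1 (fun s => (- ln (1 - s)) ^+ n.+1)
    (n.+1%:R * (- ln (1 - s)) ^+ n / (1 - s)).
Proof.
move=> s1; have d : is_derive s 1 (fun s : R => 0 - ln (1 - s)) (- ((1 - s)^-1 * - 1)).
  apply: is_derive_subl; apply: (is_derive1_comp (f := @ln R)).
    by apply: is_derive1_ln; rewrite subr_gt0.
  by apply: is_derive_subl; exact: is_derive_id.
have := is_derive_exp _ _ n _ _ d.
under [X in is_derive _ _ X]funext do rewrite sub0r.
by rewrite mulrN1 opprK sub0r.
Qed.

Lemma cvg_onem_lnXn n :
  (1 - s) * (- ln (1 - s)) ^+ n @[s --> (1:R)^'-] --> (0:R).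
Proof.
apply/cvg_at_leftP => u [u1 uc].
have /cvg_at_rightP/(_ (fun m => 1 - u m)) := @cvg_xlnXn R n.
apply; split; first by move=> m; rewrite subr_gt0.
rewrite -[X in _ --> X](subrr (1:R)); apply: cvgB => //; exact: cvg_cst.
Qed.

(** The primitives are built for all [k] at once, since the one for [q.+1] and [k] uses those for
    [q] and every [l <= k]. *)
Lemma power_onem_ln_primitive q : exists F : nat -> R -> R, forall k,
  [/\ forall s : R, s < 1 -> is_derive s 1 (F k) (s ^+ k * (- ln (1 - s)) ^+ q),
      F k 0 = 0 &
      F k s @[s --> 1^'-] --> q`!%:R * nondecsum R 1 q k.+1 / k.+1%:R].
Proof.
elim: q => [|q [F HF]].
  exists (fun k s => k.+1%:R^-1 * s ^+ k.+1) => k.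
  have k0 : (k.+1%:R : R) != 0 by [].
  split.
  - move=> s _; apply: is_derive_eq.
      by apply: is_derive_mull; apply: is_derive_exp; exact: is_derive_id.
    by field.
  - by rewrite expr0n mulr0.
  - rewrite fact0 !mul1r -[X in _ --> X]mulr1; apply: cvgMl_tmp.
    apply: cvg_at_left_filter; rewrite -[X in _ --> X](expr1n R k.+1).
    exact: exprn_continuous.
(* Integration by parts with [(s^(k+1) - 1)/(k+1)] as primitive of [s^k]: vanishing at 1, it cancels
   the [1/(1 - s)] from the logarithm and leaves the geometric sum of the [s^l]. The limits at 1
   then add up to [h_(q+1)(k+1)]. *)
exists (fun k s => k.+1%:R^-1 *
  ((s ^+ k.+1 - 1) * (- ln (1 - s)) ^+ q.+1 + q.+1%:R * \sum_(l < k.+1) F l s)).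
move=> k; have k0 : (k.+1%:R : R) != 0 by [].
have geo (s : R) : s ^+ k.+1 - 1 = (s - 1) * \sum_(l < k.+1) s ^+ l.
  exact: subrX1.
split.
- move=> s s1; apply: is_derive_eq.
    apply: is_derive_mull; apply: is_derive_add; last first.
      apply: is_derive_mull; apply: is_derive_bigsum => l.
      by have [+ _ _] := HF l; exact.
    apply: is_derive_mul; last exact: is_derive_onem_lnX.
    rewrite [X in is_derive _ _ X](_ : _ = (fun s => s ^+ k.+1) - cst 1)//.
    apply: is_deriveB; apply: is_derive_exp; exact: is_derive_id.
  rewrite -mulr_suml geo.
  have s10 : 1 - s != 0 by rewrite subr_eq0 gt_eqF.
  by field; rewrite s10 nat1r.
- rewrite expr0n subr0 ln1 oppr0 expr0n mulr0 add0r big1 ?mulr0// => l _.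
  by have [_ + _] := HF l.
- have -> : q.+1`!%:R * nondecsum R 1 q.+1 k.+1 / k.+1%:R =
    k.+1%:R^-1 * ((\sum_(l < k.+1) 1 ^+ l) * - 0 +
    q.+1%:R * \sum_(l < k.+1) (q`!%:R * nondecsum R 1 q l.+1 / l.+1%:R)).
    rewrite nondecsum_last big_add1 big_mkord oppr0 mulr0 add0r.
    rewrite factS natrM mulrC; congr (_ * _); rewrite -mulrA; congr (_ * _).
    by rewrite mulr_sumr; apply: eq_bigr => l _; rewrite -mulrA [_^-1 * _]mulrC.
  apply: cvgMl_tmp; apply: cvgD.
    rewrite (_ : (fun s : R => _) = (fun s : R => (\sum_(l < k.+1) s ^+ l) *
      - ((1 - s) * (- ln (1 - s)) ^+ q.+1))); last first.
      by apply/funext => s; rewrite geo; ring.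
    apply: cvgM; last by apply: cvgN; exact: cvg_onem_lnXn.
    apply: cvg_at_left_filter; apply: (cvg_big add_continuous) => l _.
    exact: exprn_continuous.
  apply: cvgMl_tmp; apply: (cvg_big add_continuous) => l _.
  by have [_ _ +] := HF l.
Qed.

Lemma integral_power_onem_ln k q :
  (\int[mu]_(s in `]0%R, 1%R[) (s ^+ k * (- ln (1 - s)) ^+ q)%:E =
   (q`!%:R * nondecsum R 1 q k.+1 / k.+1%:R)%:E)%E.
Proof.
have [F HF] := power_onem_ln_primitive q; have [dF F0 F1] := HF k.
rewrite -[X in X%:E]subr0; apply: ge0_FTC2oo F1 => //.
- move=> s /andP[s0 s1]; rewrite mulr_ge0 ?exprn_ge0 ?oppr_ge0 ?(ltW s0)//.
  by rewrite ln_le0// gerBl ltW.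
- move=> s /andP[s0 s1]; apply: cvgM; first exact: exprn_continuous.
  case: q {F HF dF F0} => [|q]; first exact: cvg_cst.
  apply: (@is_derive_continuous _ (fun t => (- ln (1 - t)) ^+ q.+1)).
  exact: is_derive_onem_lnX.
- by move=> s /andP[_ s1]; exact: dF.
- suff : F k s @[s --> (0:R)^'+] --> F k 0 by rewrite F0.
  apply: cvg_at_right_filter; apply: is_derive_continuous.
  by apply: dF.
Qed.

End power_log_onem_integral.

(** * Generating series and double integral *)

Section generating_series.
Variable R : realType.
Notation mu := (@lebesgue_measure R).

Lemma cvg_series_nneseries (u : nat -> R) (l : R) :
  series u @ \oo --> l -> (\sum_(k <oo) (u k)%:E = l%:E)%E.
Proof.
move=> ul; apply/cvg_lim => //.
under eq_fun do rewrite sumEFin.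
by apply: cvg_EFin => //; exact: nearW.
Qed.

Lemma nneseries_cvg_series (u : nat -> R) (l : R) : (forall k, 0 <= u k) ->
  (\sum_(k <oo) (u k)%:E = l%:E)%E -> series u @ \oo --> l.
Proof.
move=> u0 ul.
have : (\sum_(0 <= k < n) (u k)%:E)%E @[n --> \oo] --> l%:E.
  by rewrite -ul; apply: is_cvg_nneseries => k _ _; rewrite lee_fin.
move/fine_cvg; under eq_fun do rewrite /= sumEFin.
by [].
Qed.

(** Nonnegativity alone permits termwise integration. It serves for the generating series and for
    each variable of the double integral. *)
Lemma integral_power_series (a b : R) (f : R -> R) (c v : nat -> R) :
  0 <= a -> measurable_fun `]a, b[ f ->
  (forall t, a < t < b -> 0 <= f t) -> (forall k, 0 <= c k) ->
  (forall k, (\int[mu]_(t in `]a, b[) (t ^+ k * f t)%:E = (v k)%:E)%E) ->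
  (\int[mu]_(t in `]a, b[) (\sum_(k <oo) (c k * (t ^+ k * f t))%:E) =
   \sum_(k <oo) (c k * v k)%:E)%E.
Proof.
move=> a0 mf f0 c0 vE.
have mtf k : measurable_fun `]a, b[ (fun t => t ^+ k * f t).
  by apply: measurable_funM => //; exact: measurable_funX.
have tf0 k t : `]a, b[%classic t -> (0 <= (t ^+ k * f t)%:E)%E.
  rewrite /= in_itv/= => /andP[at_ tb].
  by rewrite lee_fin mulr_ge0 ?f0 ?at_// exprn_ge0// (le_trans a0)// ltW.
rewrite integral_nneseries//.
- apply: eq_eseriesr => k _; under eq_integral do rewrite EFinM.
  rewrite ge0_integralZl_EFin//; [by rewrite vE EFinM|exact: tf0|].
  by apply/measurable_EFinP; exact: mtf.
- move=> k; apply/measurable_EFinP; apply: measurable_funM; last exact: mtf.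
  exact: measurable_cst.
- by move=> k t /(tf0 k); rewrite !lee_fin => ?; rewrite mulr_ge0.
Qed.

(** Monotonicity of [X] in the recurrence gives [(1 - t) X n <= Y n <= y], so [X] converges, and its
    limit solves [x = t x + y]. *)
Lemma cvg_affine_rec (t y : R) (X Y : nat -> R) : 0 <= t < 1 ->
  nondecreasing_seq X -> nondecreasing_seq Y -> Y n @[n --> \oo] --> y ->
  (forall n, X n.+1 = t * X n + Y n) -> X n @[n --> \oo] --> y / (1 - t).
Proof.
move=> /andP[t0 t1] ndX ndY Yy XE.
have t10 : 0 < 1 - t by rewrite subr_gt0.
have Yle n : Y n <= y.
  rewrite -(cvg_lim _ Yy)//; apply: nondecreasing_cvgn_le => //.
  by apply/cvg_ex; exists y.
have cX : cvgn X.
  apply: nondecreasing_is_cvgn => //; exists (y / (1 - t)) => _ [n _ <-].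
  rewrite ler_pdivlMr//.
  by have := ndX _ _ (leqnSn n); rewrite XE; have := Yle n; lra.
have Xl : limn X = t * limn X + y.
  transitivity (limn (fun n => X n.+1)).
    by apply/esym/cvg_lim => //; rewrite (cvg_shiftS X).
  apply/cvg_lim => //; under eq_fun do rewrite XE.
  by apply: cvgD => //; apply: cvgMl_tmp.
suff -> : y / (1 - t) = limn X by [].
apply: (mulIf (lt0r_neq0 t10)); rewrite divfK ?lt0r_neq0//.
by rewrite mulrBr mulr1 {1}Xl; ring.
Qed.

(** Induction on [p]: integrating the series for [p] over []0, t[] gives [Y], and as
    [e_(p+1)(k+1) - e_(p+1)(k) = e_p(k)/(k+1)], multiplying the series for [p.+1] by [1 - t] also
    gives [Y]. *)
Lemma cvg_elem_sum_series p (t : R) : 0 < t < 1 ->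
  series (fun k => t ^+ k * incsum R 0 (nseq p 1%N) k) @ \oo -->
  (- ln (1 - t)) ^+ p / (p`!%:R * (1 - t)).
Proof.
elim: p t => [|p IH] t /andP[t0 t1].
  rewrite fact0 expr0 !mul1r.
  have /cvg_geometric_series : `|t| < 1 by rewrite gtr0_norm.
  move=> /(_ 1); rewrite mul1r; apply: cvg_trans; apply: near_eq_cvg.
  apply: nearW => N; rewrite /series/=; apply: eq_bigr => k _.
  by rewrite mulr1 mul1r.
set E := fun p => incsum R 0 (nseq p 1%N).
have E0 p' k : 0 <= E p' k by exact: incsum_ge0.
have t10 : 0 < 1 - t by rewrite subr_gt0.
pose Y := series (fun k => E p k * (t ^+ k.+1 / k.+1%:R)).
have Yl : Y n @[n --> \oo] --> (- ln (1 - t)) ^+ p.+1 / p.+1`!%:R.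
  apply: nneseries_cvg_series => [k|].
    by rewrite mulr_ge0// divr_ge0// exprn_ge0// ltW.
  rewrite -(@integral_power_series 0 t (fun=> 1) (E p))//; last first.
    (* The plain integral of [u^k] is the case of logarithmic exponent 0. *)
    move=> k; under eq_integral => u _ do rewrite -[1](expr0 (ln t - ln u)).
    by rewrite integral_power_ln// fact0 mul1r expr1.
  have -> : (- ln (1 - t)) ^+ p.+1 / p.+1`!%:R =
      p.+1`!%:R^-1 * (- ln (1 - t)) ^+ p.+1 -
      p.+1`!%:R^-1 * (- ln (1 - 0)) ^+ p.+1.
    by rewrite subr0 ln1 oppr0 expr0n mulr0 subr0 mulrC.
  have p0 : (p`!%:R : R) != 0 by rewrite pnatr_eq0 -lt0n fact_gt0.
  have dF (u : R) : u < 1 -> is_derive u 1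
      (fun u => p.+1`!%:R^-1 * (- ln (1 - u)) ^+ p.+1)
      ((- ln (1 - u)) ^+ p / (p`!%:R * (1 - u))).
    move=> u1; apply: is_derive_eq.
      by apply: is_derive_mull; exact: is_derive_onem_lnX.
    have u10 : 1 - u != 0 by rewrite subr_eq0 gt_eqF.
    by rewrite factS natrM; field; rewrite u10 p0 nat1r pnatr_eq0.
  transitivity (\int[mu]_(u in `]0%R, t[)
      ((- ln (1 - u)) ^+ p / (p`!%:R * (1 - u)))%:E)%E.
    apply: eq_integral => u; rewrite inE/= in_itv/= => /andP[u0 ut].
    rewrite -(cvg_series_nneseries _ _ (IH u _)) ?u0 ?(lt_trans ut)//.
    by apply: eq_eseriesr => k _; rewrite mulr1 mulrC.
  apply: (@ge0_FTC2oo _ (fun u => (- ln (1 - u)) ^+ p / (p`!%:R * (1 - u)))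
     (fun u => p.+1`!%:R^-1 * (- ln (1 - u)) ^+ p.+1) 0 t) => //.
  - move=> u /andP[u0 ut]; have u1 := lt_trans ut t1.
    rewrite divr_ge0 ?mulr_ge0 ?subr_ge0 ?(ltW u1)//.
    by rewrite exprn_ge0// oppr_ge0 ln_le0// gerBl ltW.
  - move=> u /andP[u0 ut]; have u1 := lt_trans ut t1.
    apply: cvgM.
      case: {IH Y dF} p {p0 E0} => [|p]; first exact: cvg_cst.
      apply: (@is_derive_continuous _ (fun u => (- ln (1 - u)) ^+ p.+1)).
      exact: is_derive_onem_lnX.
    apply: cvgV; first by rewrite mulf_neq0// subr_eq0 gt_eqF.
    by apply: cvgMl_tmp; apply: cvgB; [exact: cvg_cst|exact: cvg_id].
  - by move=> u /andP[_ ut]; apply: dF; exact: lt_trans ut t1.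
  - apply: cvg_at_right_filter; exact: (is_derive_continuous _ _ _ _ (dF 0 ltr01)).
  - apply: cvg_at_left_filter; exact: (is_derive_continuous _ _ _ _ (dF t t1)).
have -> : (- ln (1 - t)) ^+ p.+1 / (p.+1`!%:R * (1 - t)) =
   (- ln (1 - t)) ^+ p.+1 / p.+1`!%:R / (1 - t) by rewrite invfM mulrA.
apply: cvg_affine_rec Yl _; first by rewrite ltW.
- apply/nondecreasing_seqP => n; rewrite /series/= big_nat_recr//= lerDl.
  by apply: mulr_ge0; [rewrite exprn_ge0// ltW|exact: (E0 p.+1)].
- apply/nondecreasing_seqP => n; rewrite /Y/series/= big_nat_recr//= lerDl.
  by rewrite mulr_ge0// divr_ge0// exprn_ge0// ltW.
(* The term of index 0 vanishes because [e_(p+1)(0) = 0]; the rest is shifted by one. *)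
move=> N; rewrite /Y/series big_nat_recl// elem_sum0 mulr0 add0r.
rewrite mulr_sumr -big_split; apply: eq_bigr => k _.
rewrite elem_sumS [t ^+ k.+1]exprS /E; set e := incsum R 0 (nseq p.+1 _) k.
by rewrite /=; ring.
Qed.

End generating_series.

(** * Tonelli on the triangle [E2] *)

Section double_integral.
Variable R : realType.
Notation mu := (@lebesgue_measure R).

Lemma measurable_E2 : measurable (@E2 R).
Proof.
have pos (f : R * R -> R) : measurable_fun setT f ->
    measurable [set t | 0 < f t].
  move=> mf; rewrite [X in measurable X](_ : _ = setT `&` f @^-1` `]0, +oo[).
    by apply: mf => //; exact: measurable_itv.
  by apply/seteqP; split => t /=; rewrite in_itv/= andbT; [|case].
rewrite [X in measurable X](_ : _ = [set t : R * R | 0 < t.1] `&`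
  ([set t : R * R | 0 < t.2 - t.1] `&` [set t : R * R | 0 < 1 - t.2])).
  apply: measurableI; first by apply: pos; exact: measurable_fst.
  apply: measurableI; apply: pos.
    by apply: measurable_funB; [exact: measurable_snd|exact: measurable_fst].
  by apply: measurable_funB; [exact: measurable_cst|exact: measurable_snd].
by apply/seteqP; split => t; rewrite /E2/= !subr_gt0.
Qed.

Lemma integrandE n p q (t : R * R) : E2 t ->
  integrand n p q t =
  (- ln (1 - t.1)) ^+ p * (- ln (1 - t.2)) ^+ q * (ln t.2 - ln t.1) ^+ n /
  ((1 - t.1) * t.2).
Proof.
move=> [t0 [tt t1]]; have t20 := lt_trans t0 tt.
by rewrite /integrand !div1r ln_div ?lnV ?posrE ?subr_gt0// (lt_trans tt).
Qed.

Lemma integrand_ge0 n p q (t : R * R) : E2 t -> 0 <= integrand n p q t.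
Proof.
move=> Et; rewrite integrandE//; case: Et => [t0 [tt t1]].
have t20 := lt_trans t0 tt; have t11 := lt_trans tt t1.
rewrite divr_ge0 ?mulr_ge0 ?exprn_ge0 ?subr_ge0 ?oppr_ge0 ?(ltW t20) ?(ltW t11)//.
- by rewrite ln_le0// gerBl ltW.
- by rewrite ln_le0// gerBl ltW.
- by rewrite ler_ln ?posrE// ltW.
Qed.

Lemma measurable_integrand n p q : measurable_fun (@E2 R) (integrand n p q).
Proof.
(* On [E2] the denominator is positive, so its inverse is the exponential of minus its logarithm;
   this makes [g] measurable on the whole plane. *)
pose g (t : R * R) : R := (- ln (1 - t.1)) ^+ p * (- ln (1 - t.2)) ^+ q *
  (ln t.2 - ln t.1) ^+ n * expR (- (ln (1 - t.1) + ln t.2)).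
apply: (eq_measurable_fun g).
  move=> t /set_mem Et; rewrite /g integrandE//; congr (_ * _).
  case: Et => [t0 [tt t1]].
  have t20 := lt_trans t0 tt; have t11 := lt_trans tt t1.
  by rewrite expRN expRD !lnK ?posrE ?subr_gt0.
apply: measurable_funTS.
have m1 : measurable_fun setT (fun t : R * R => t.1) by exact: measurable_fst.
have m2 : measurable_fun setT (fun t : R * R => t.2) by exact: measurable_snd.
have ml (f : R * R -> R) : measurable_fun setT f ->
    measurable_fun setT (fun t => ln (f t)).
  by move=> mf; apply: measurableT_comp => //; exact: measurable_ln.
have m1m (f : R * R -> R) : measurable_fun setT f ->
    measurable_fun setT (fun t => 1 - f t).
  by move=> mf; apply: measurable_funB => //; exact: measurable_cst.
have mN (f : R * R -> R) : measurable_fun setT f ->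
    measurable_fun setT (fun t => - f t).
  by move=> mf; apply: measurableT_comp.
apply: measurable_funM.
  apply: measurable_funM; first apply: measurable_funM.
  - by apply: measurable_funX; apply: mN; apply: ml; apply: m1m.
  - by apply: measurable_funX; apply: mN; apply: ml; apply: m1m.
  - by apply: measurable_funX; apply: measurable_funB; apply: ml.
apply: measurableT_comp; first exact: measurable_expR.
by apply: mN; apply: measurable_funD; [apply: ml; apply: m1m|apply: ml].
Qed.

Lemma integral_integrand_section n p q (y : R) : 0 < y < 1 ->
  (\int[mu]_(x in `]0%R, y[) (integrand n p q (x, y))%:E =
   \sum_(k <oo) (p`!%:R * n`!%:R / k.+1%:R ^+ n.+1 *
      incsum R 0 (nseq p 1%N) k * (y ^+ k * (- ln (1 - y)) ^+ q))%:E)%E.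
Proof.
move=> /andP[y0 y1]; set L := (- ln (1 - y)) ^+ q.
have L0 : 0 <= L by rewrite exprn_ge0// oppr_ge0 ln_le0// gerBl ltW.
have yn0 : y != 0 by rewrite gt_eqF.
have pn0 : (p`!%:R : R) != 0 by rewrite pnatr_eq0 -lt0n fact_gt0.
(* [p! L / y] collects what is constant in [x] once [(log 1/(1 - x))^p/(1 - x)] is expanded; its
   [1/y] later reduces [y^(k+1)] to [y^k]. *)
transitivity (\sum_(k <oo) ((p`!%:R * L / y * incsum R 0 (nseq p 1%N) k) *
   (n`!%:R * y ^+ k.+1 / k.+1%:R ^+ n.+1))%:E)%E; last first.
  apply: eq_eseriesr => k _; congr EFin; rewrite exprS.
  have kn0 : (k.+1%:R ^+ n.+1 : R) != 0 by rewrite expf_neq0.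
  by field; rewrite yn0 kn0.
rewrite -(@integral_power_series _ 0 y (fun x => (ln y - ln x) ^+ n))//.
- apply: eq_integral => x; rewrite inE/= in_itv/= => /andP[x0 xy].
  have x1 := lt_trans xy y1.
  have := @cvg_elem_sum_series R p x; rewrite x0 x1 => /(_ isT) xs.
  have c0 : 0 <= p`!%:R * L / y * (ln y - ln x) ^+ n.
    by rewrite mulr_ge0 ?divr_ge0 ?mulr_ge0 ?(ltW y0)// exprn_ge0// subr_ge0
      ler_ln ?posrE// ltW.
  transitivity ((p`!%:R * L / y * (ln y - ln x) ^+ n)%:E *
    \sum_(k <oo) (x ^+ k * incsum R 0 (nseq p 1%N) k)%:E)%E.
    rewrite (cvg_series_nneseries _ _ _ xs) -EFinM integrandE; last by split.
    congr EFin; rewrite /= -/L.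
    have x10 : 1 - x != 0 by rewrite subr_eq0 gt_eqF.
    by field; rewrite yn0 x10 pn0.
  rewrite -nneseriesZl; last first.
    move=> k _; rewrite lee_fin mulr_ge0 ?incsum_ge0// exprn_ge0// ltW//.
  by apply: eq_eseriesr => k _; rewrite -EFinM; congr EFin; ring.
- apply: measurable_funX; apply: measurable_funB; first exact: measurable_cst.
  by apply: measurable_funTS; exact: measurable_ln.
- move=> x /andP[x0 xy]; rewrite exprn_ge0// subr_ge0 ler_ln ?posrE// ltW//.
- by move=> k; rewrite mulr_ge0 ?incsum_ge0// divr_ge0 ?mulr_ge0// ltW.
- by move=> k; exact: integral_power_ln.
Qed.

Lemma G_series n p q :
  G R n p q = (\sum_(k <oo) (k.+1%:R ^- (n + 2) * incsum R 0 (nseq p 1%N) k *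
    nondecsum R 1 q k.+1)%:E)%E.
Proof.
rewrite /G; congr (limn _); apply/funext => N.
by rewrite /G_trunc big_add1 sumEFin.
Qed.

Lemma G_integral n p q :
  @G R n p q =
    (((p`! * q`! * n`!)%:R^-1)%:E *
    \int[(@lebesgue_measure R) \x (@lebesgue_measure R)]_(t in @E2 R)
       (integrand n p q t)%:E)%E.
Proof.
pose h : R * R -> \bar R := (fun t => (integrand n p q t)%:E) \_ (@E2 R).
have h0 t : (0 <= h t)%E.
  by apply: erestrict_ge0 => {}t Et; rewrite lee_fin integrand_ge0.
have mh : measurable_fun setT h.
  apply/(measurable_restrictT _ measurable_E2).
  by apply/measurable_EFinP; exact: measurable_integrand.
(* The horizontal section of [E2] at height [y] is []0, y[] if [0 < y < 1] and empty otherwise, so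
   the outer integral lives on []0, 1[]. *)
have secE y : (\int[mu]_x h (x, y) = ((fun y =>
    \sum_(k <oo) (p`!%:R * n`!%:R / k.+1%:R ^+ n.+1 *
      incsum R 0 (nseq p 1%N) k * (y ^+ k * (- ln (1 - y)) ^+ q))%:E)
     \_ `]0%R, 1%R[) y)%E.
  rewrite patchE; case: ifPn => [/set_mem/=|/negP y01].
    rewrite in_itv/= => y01; rewrite -integral_integrand_section//.
    rewrite [RHS]integral_mkcond; apply: eq_integral => x _.
    rewrite /h !patchE; congr (if _ then _ else _).
    apply/idP/idP => /set_mem xE2; apply/mem_set.
      by case: xE2 => x0 [xy y1]; rewrite /= in_itv/= x0.
    move: xE2; rewrite /= in_itv/= => /andP[x0 xy].
    by case/andP: y01.
  apply: integral0_eq => x _; rewrite /h patchE ifF//; apply/negP => /set_mem.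
  move=> [x0 [xy y1]]; apply: y01; apply/mem_set.
  by rewrite /= in_itv/= (lt_trans x0).
have -> : (\int[mu \x mu]_(t in @E2 R) (integrand n p q t)%:E =
  \sum_(k <oo) ((p`!%:R * n`!%:R / k.+1%:R ^+ n.+1 *
      incsum R 0 (nseq p 1%N) k) *
     (q`!%:R * nondecsum R 1 q k.+1 / k.+1%:R))%:E)%E.
  rewrite integral_mkcond fubini_tonelli2// /fubini_G.
  under eq_integral do rewrite secE.
  rewrite -integral_mkcond; apply: integral_power_series => //.
  - apply: measurable_funX; apply: measurableT_comp => //.
    apply: measurable_funTS; apply: measurableT_comp; first exact: measurable_ln.
    by apply: measurable_funB.
  - by move=> s /andP[s0 s1]; rewrite exprn_ge0// oppr_ge0 ln_le0// gerBl ltW.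
  - by move=> k; rewrite mulr_ge0 ?incsum_ge0// divr_ge0 ?mulr_ge0// exprn_ge0.
  - by move=> k; exact: integral_power_onem_ln.
rewrite G_series -nneseriesZl; last first.
  move=> k _; rewrite lee_fin mulr_ge0 ?divr_ge0 ?mulr_ge0//.
  - exact: incsum_ge0.
  - exact: nondecsum_ge0.
apply: eq_eseriesr => k _; rewrite -EFinM; congr EFin.
(* The inner integral contributes [(k+1)^-(n+1)] and the outer one [1/(k+1)], which together give
   the exponent [n + 2]; the factorials cancel. *)
rewrite addn2 [_ ^+ n.+2]exprS !natrM.
have fn0 m : (m`!%:R : R) != 0 by rewrite pnatr_eq0 -lt0n fact_gt0.
rewrite !invfM; set a := (_ ^+ n.+1)^-1; set b := k.+1%:R^-1.
by field; rewrite !fn0.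
Qed.

End double_integral.

Local Open Scope ereal_scope.

Theorem theorem2p2 (R : realType) (n p q : nat) :
  @G R n p q =
    \sum_(p.+1 <= r < (p + q).+2)
       ('C(r.-1, p)%:R)%:E *
       \sum_(a : {ffun 'I_r -> 'I_(p + q).+2} | compositions a)
          @mzv R (shift_last (n.+1) a)
  /\
  @G R n p q =
    ((p`! * q`! * n`!)%:R^-1)%:E *
    \int[(@lebesgue_measure R) \x (@lebesgue_measure R)]_(t in @E2 R)
       (integrand n p q t)%:E.
Proof. by split; [exact: G_mzv|exact: G_integral]. Qed.
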